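(* Let $k\ge1$, $p\ge1$ and $y\in(0,\infty)$ be given. An optimal $k$-step additive linear multistep method of order $p$ has $\beta_j=\hat\beta_j$ for all $j\in\{0,\dots,k\}$.
   Context: A $k$-step additive linear multistep method for $\mathbf{u}'=\mathbf{F}(\mathbf{u})+\widehat{\mathbf{F}}(\mathbf{u})$ is given by real coefficients $\alpha_0,\dots,\alpha_{k-1}$, $\beta_0,\dots,\beta_k$, $\hat\beta_0,\dots,\hat\beta_k$, and reads $$\mathbf{u}_n=\sum_{j=0}^{k-1}\alpha_j\mathbf{u}_{n-k+j}+\Delta t\sum_{j=0}^k\left(\beta_j\mathbf{F}(\mathbf{u}_{n-k+j})+\hat\beta_j\widehat{\mathbf{F}}(\mathbf{u}_{n-k+j})\right).$$ It is explicit if $\beta_k=\hat\beta_k=0$. It has order $p$ if $\sum_{j=0}^{k-1}\alpha_j=1$, $\sum_{j=0}^{k-1}j\alpha_j+\sum_{j=0}^k\beta_j=k$, $\sum_{j=0}^{k-1}j\alpha_j+\sum_{j=0}^k\hat\beta_j=k$, and for $i\in\{2,\dots,p\}$ both $\sum_{j=0}^{k-1}\alpha_jj^i+\sum_{j=0}^k\beta_j\,i\,j^{i-1}=k^i$ and $\sum_{j=0}^{k-1}\alpha_jj^i+\sum_{j=0}^k\hat\beta_j\,i\,j^{i-1}=k^i$. Monotonicity conditions for $(r,\hat r)$, $r,\hat r\ge0$: $\beta_j,\hat\beta_j\ge0$ for $j\in\{0,\dots,k\}$, and $\alpha_j-r\beta_j-\hat r\hat\beta_j\ge0$ for $j\in\{0,\dots,k-1\}$.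 For fixed $y=\hat r/r$, the method has SSP coefficient $$\mathcal{C}(y)=\sup\{r\ge0:\ \text{the monotonicity conditions hold with }\hat r=yr\}$$ and corresponding coefficient $\widehat{\mathcal{C}}(y)=y\,\mathcal{C}(y)$. $\mathcal{C}_{k,p}(y)$ is the supremum of all $\mathcal{C}(y)>0$ that are SSP coefficients of $k$-step additive linear multistep methods of order $p$; a $k$-step SSP additive method of order $p$ is optimal if $\mathcal{C}(y)=\mathcal{C}_{k,p}(y)$. The result is meant both for the class of all such methods (implicit methods allowed) and for the class of explicit methods, with the supremum then taken over explicit methods only. *)

(* Defs.v *)
From mathcomp Require Import all_boot all_order all_algebra.
From mathcomp Require Import classical_sets reals ereal.

Set Implicit Arguments.
Unset Strict Implicit.
Unset Printing Implicit Defensive.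

Import Order.TTheory GRing.Theory Num.Theory.

Local Open Scope classical_set_scope.
Local Open Scope ring_scope.

(* A k-step additive linear multistep method, identified with its coefficients:
     u_n = \sum_(j < k) alpha_j u_(n-k+j)
           + dt \sum_(j < k.+1) (beta_j F(u_(n-k+j)) + betah_j Fh(u_(n-k+j))). *)
Record almm (R : realType) (k : nat) := Almm {
  alpha : 'I_k -> R;
  beta : 'I_k.+1 -> R;
  betah : 'I_k.+1 -> R
}.

Section AdditiveLMM.
Variables (R : realType) (k : nat).
Implicit Types (m : almm R k) (S : set (almm R k)).

Definition explicit m : Prop := beta m ord_max = 0 /\ betah m ord_max = 0.

(* As usual, "order p" means order at least p. *)
Definition has_order (p : nat) m : Prop :=
  [/\ \sum_(j < k) alpha m j = 1,
      \sum_(j < k) j%:R * alpha m j + \sum_(j < k.+1) beta m j = k%:R,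
      \sum_(j < k) j%:R * alpha m j + \sum_(j < k.+1) betah m j = k%:R
    & forall i : nat, (2 <= i <= p)%N ->
        \sum_(j < k) alpha m j * j%:R ^+ i
          + \sum_(j < k.+1) beta m j * i%:R * j%:R ^+ i.-1 = k%:R ^+ i /\
        \sum_(j < k) alpha m j * j%:R ^+ i
          + \sum_(j < k.+1) betah m j * i%:R * j%:R ^+ i.-1 = k%:R ^+ i].

Definition monotonicity m (r rh : R) : Prop :=
  (forall j : 'I_k.+1, 0 <= beta m j /\ 0 <= betah m j) /\
  (forall j : 'I_k, 0 <= alpha m j - r * beta m (widen_ord (leqnSn k) j)
                         - rh * betah m (widen_ord (leqnSn k) j)).

(* The supremum is taken in the extended reals: it is +oo for some implicit
   methods (e.g. backward Euler), and -oo if no r is admissible. *)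
Definition ssp_coef m (y : R) : \bar R :=
  ereal_sup [set r%:E | r in [set r : R | 0 <= r /\ monotonicity m r (y * r)]].

Definition ssp_method m (y : R) : Prop := (0 < ssp_coef m y)%E.

(* C_{k,p}(y), relative to a class S of methods. *)
Definition optimal_ssp_coef S (p : nat) (y : R) : \bar R :=
  ereal_sup [set ssp_coef m y | m in
    [set m : almm R k | [/\ S m, has_order p m & ssp_method m y]]].

Definition optimal S (p : nat) (y : R) m : Prop :=
  [/\ S m, has_order p m, ssp_method m y
    & ssp_coef m y = optimal_ssp_coef S p y].

End AdditiveLMM.

(* Main.v *)
(* Replacing both betas of an optimal method by their weighted average
   g = (beta + y betah) / (1 + y) keeps the order and the SSP coefficient, so
   that alpha >= r g with r = (1 + y) C(y).  The difference beta - betah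
   annihilates all polynomials of degree < p at the nodes 0, ..., k; if it is
   nonzero, it is supported on more than p nodes, hence so is g >= 0.  For a
   polynomial q of degree at most p, r q + q' cannot vanish at more than p nodes
   unless q = 0; dually, the order conditions can be solved with any prescribed
   value of alpha - r beta, using only the nodes where g > 0.  Moving (alpha, g)
   along such a solution makes the monotonicity conditions strict on the support
   of g, which leaves room for a larger r and contradicts optimality. *)
Require Import Defs.
From mathcomp Require Import all_boot all_order all_algebra.
From mathcomp Require Import classical_sets reals ereal.
From mathcomp Require Import ring lra.

Import Order.TTheory GRing.Theory Num.Theory.
Local Open Scope classical_set_scope.
Local Open Scope ring_scope.

(** * Polynomials at the nodes *)

Lemma support_size_gt (F : numDomainType) (n p : nat) (d : 'I_n -> F) (j0 : 'I_n) :
  d j0 != 0 ->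
  (forall i, (i < p)%N -> \sum_j d j * j%:R ^+ i = 0) ->
  (p < #|[pred j | d j != 0%R]|)%N.
Proof.
move=> dj0 dp; rewrite ltnNge; apply/negP => le_p.
set T := [pred j | d j != 0%R] in le_p.
(* If the support [T] had at most [p] nodes, this [q] would have degree below [p], yet its pairing
   with [d] reduces to the nonzero term at [j0]. *)
pose q : {poly F} := \prod_(j <- enum (predD1 T j0)) ('X - (j%:R)%:P).
have size_q : (size q <= p)%N.
  rewrite size_prod_XsubC -cardE.
  by move: le_p; rewrite (cardD1 j0 T) inE /= dj0.
have q_eq0 (j : 'I_n) : (q.[j%:R] == 0) = (j \in predD1 T j0).
  rewrite horner_prod prodf_seq_eq0; apply/hasP/idP => [[i]|Tj].
    rewrite mem_enum !hornerE subr_eq0 eqr_nat => Ti /eqP ji.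
    by rewrite (val_inj ji).
  by exists j; rewrite ?mem_enum // !hornerE subrr eqxx.
have : \sum_j d j * q.[j%:R] = 0.
  under eq_bigr do rewrite (horner_coef_wide _ size_q) mulr_sumr.
  rewrite exchange_big big1 //= => i _.
  under eq_bigr do rewrite mulrCA.
  by rewrite -mulr_sumr dp ?mulr0.
rewrite (bigD1 j0) //= big1 ?addr0 => [|j jj0].
  by apply/eqP; rewrite mulf_neq0 // q_eq0 inE /= eqxx.
have [->|dj] := eqVneq (d j) 0; first by rewrite mul0r.
by have /eqP -> : q.[j%:R] == 0; rewrite ?mulr0 // q_eq0 inE /= jj0.
Qed.

(** Differentiation lowers the degree of a nonzero [q], so it cannot cancel [r *: q]. *)
Lemma scale_deriv_eq0 (F : numFieldType) (r : F) (q : {poly F}) :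
  r != 0 -> r *: q + q^`() = 0 -> q = 0.
Proof.
move=> r0 /eqP; rewrite addr_eq0 => /eqP e; apply/eqP; apply/negPn/negP => q0.
by have := lt_size_deriv q0; rewrite -size_polyN -e size_scale // ltnn.
Qed.

Lemma shifted_deriv_solve (F : numFieldType) (n p : nat) (r : F) (S : pred 'I_n)
    (v : nat -> F) :
  r != 0 -> (p < #|S|)%N ->
  exists b : 'I_n -> F, (forall j, ~~ S j -> b j = 0) /\
    forall i, (i <= p)%N ->
      \sum_j b j * (r * j%:R ^+ i + i%:R * j%:R ^+ i.-1) = v i.
Proof.
move=> r0 ltpS.
pose M := \matrix_(j < n, i < p.+1)
  ((S j)%:R * (r * j%:R ^+ i + i%:R * j%:R ^+ i.-1) : F).
have fullM : row_full M.
  suff: row_free M^T by rewrite /row_free /row_full mxrank_tr.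
  apply: inj_row_free => u uM.
  pose q := rVpoly u.
  have size_q : (size q <= p.+1)%N by rewrite size_poly.
  suff q0 : q = 0 by rewrite -[u]rVpolyK -/q q0 linear0.
  apply: (scale_deriv_eq0 _ r) => //.
  set t := _ + _.
  have size_t : (size t <= p.+1)%N.
    rewrite (leq_trans (size_polyD _ _)) // geq_max (leq_trans (size_scale_leq _ _)) //=.
    by rewrite (leq_trans (size_poly _ _)) // (leq_trans (leq_pred _)).
  apply/eqP; apply/negPn/negP => t0.
  have : (#|S| < size t)%N.
    rewrite cardE -(size_map (fun j : 'I_n => j%:R : F)).
    apply: max_poly_roots => //.
      apply/allP => x /mapP[j]; rewrite mem_enum unfold_in => Sj ->{x}.
      have := congr1 (fun A : 'rV_n => A 0 j) uM.
      rewrite !mxE => e; apply/rootP; rewrite -[RHS]e /t /q /rVpoly poly_def.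
      rewrite hornerD hornerZ raddf_sum /= !horner_sum mulr_sumr -big_split /=.
      apply: eq_bigr => i _; rewrite !mxE Sj mul1r insubT // => lti.
      rewrite derivZ derivXn !hornerZ hornerMn !hornerXn.
      rewrite (_ : Sub _ _ = i); last exact: val_inj.
      by rewrite -[_ *+ i]mulr_natl; ring.
    rewrite map_inj_uniq ?enum_uniq // => i j /eqP.
    by rewrite eqr_nat => /eqP /val_inj.
  by move=> /leq_trans /(_ size_t); rewrite ltnS leqNgt ltpS.
have /submxP[D DM] := submx_full (\row_(i < p.+1) v i) fullM.
exists (fun j => (S j)%:R * D 0 j); split=> [j /negbTE ->|i lei]; first by rewrite mul0r.
have := congr1 (fun A : 'rV_p.+1 => A 0 (Ordinal (lei : (i < p.+1)%N))) DM.
rewrite !mxE /= => ->; apply: eq_bigr => j _; rewrite !mxE /=; ring.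
Qed.

(** * Strict improvement by a small perturbation *)

Lemma exists_small_scale (F : realFieldType) (n : nat) (x y : 'I_n -> F) :
  (forall j, 0 < x j) ->
  exists2 e : F, 0 < e & forall j, e * `|y j| <= x j.
Proof.
(* [s] exceeds every quotient of [|y j|] by [x j], so its inverse serves as [e]. *)
move=> x0; pose s := 1 + \sum_j `|y j| / x j.
have t0 j : 0 <= `|y j| / x j by rewrite divr_ge0 // ltW.
have s0 : 0 < s by rewrite ltr_pwDl // sumr_ge0.
exists s^-1; rewrite ?invr_gt0 // => j.
rewrite mulrC ler_pdivrMr // mulrC -ler_pdivrMr // /s (bigD1 j) //=.
have : 0 <= \sum_(i < n | i != j) `|y i| / x i by rewrite sumr_ge0.
lra.
Qed.

Lemma improve_lmm (F : realFieldType) (k p : nat) (r : F)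
    (a : 'I_k -> F) (g : 'I_k.+1 -> F) :
  0 < r -> (forall j, 0 <= g j) ->
  (forall j, r * g (widen_ord (leqnSn k) j) <= a j) ->
  (p < #|[pred j | (0 < g j)%R]|)%N ->
  (forall i, (i <= p)%N ->
     \sum_j a j * j%:R ^+ i + \sum_j g j * i%:R * j%:R ^+ i.-1 = k%:R ^+ i) ->
  exists r' a' g',
  [/\ r < r', forall j : 'I_k.+1, 0 <= g' j,
      forall j : 'I_k, r' * g' (widen_ord (leqnSn k) j) <= a' j,
      g ord_max = 0 -> g' ord_max = 0 &
      forall i, (i <= p)%N ->
        \sum_j a' j * j%:R ^+ i + \sum_j g' j * i%:R * j%:R ^+ i.-1
          = k%:R ^+ i].
Proof.
move=> r0 g0 ag pS ord.
set S := [pred j | 0 < g j] in pS.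
have gS j : ~~ S j -> g j = 0.
  by rewrite /= -leNgt => gj; apply/eqP; rewrite eq_le gj g0.
(* This right-hand side makes [(c, b)] below solve the homogeneous order conditions, with [c - r b]
   the indicator of [S]. *)
have [b [bS b_eq]] := @shifted_deriv_solve F k.+1 p r S
  (fun i => - \sum_j (S j)%:R * j%:R ^+ i) (lt0r_neq0 r0) pS.
(* Moving along (c, b) perturbs also the coefficient -1 of u_n; the perturbed
   method is renormalized below by s = 1 - e * c_k. *)
pose c j := r * b j + (S j)%:R.
have c_eq i : (i <= p)%N ->
    \sum_j c j * j%:R ^+ i + \sum_j b j * i%:R * j%:R ^+ i.-1 = 0.
  move=> lei; rewrite -big_split /=.
  apply: etrans (subrr (\sum_j (S j)%:R * j%:R ^+ i)); rewrite -b_eq // -big_split /=.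
  apply: eq_bigr => j _; rewrite /c; ring.
(* Off [S] the bound 1 is a dummy, since [b] vanishes there. The bound 1/2 for [e2] keeps [s]
   positive. *)
have x_gt0 j : 0 < (if S j then g j else 1) by case: ifP.
have [e1 e1_gt0 e1P] := exists_small_scale _ _ _ b x_gt0.
have half_gt0 : 'I_1 -> 0 < 2^-1 :> F by rewrite invr_gt0 ltr0n.
have [e2 e2_gt0 e2P] := exists_small_scale _ _ _ (fun=> c ord_max) half_gt0.
move: {half_gt0 e2P}(e2P ord0) => e2P.
pose e := Num.min e1 e2.
have e_gt0 : 0 < e by rewrite lt_min e1_gt0.
have gb_ge0 j : 0 <= g j + e * b j.
  have [Sj|Sj] := boolP (S j); last by rewrite gS // bS // mulr0 addr0.
  have := e1P j; rewrite Sj => h.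
  have : e * `|b j| <= e1 * `|b j| by rewrite ler_wpM2r // ge_min lexx.
  have : - (e * `|b j|) <= e * b j by rewrite -mulrN ler_pM2l // lerNl ler_normr lexx orbT.
  lra.
pose s := 1 - e * c ord_max.
have s_gt0 : 0 < s.
  have : e * `|c ord_max| <= e2 * `|c ord_max| by rewrite ler_wpM2r // ge_min lexx orbT.
  have : e * c ord_max <= e * `|c ord_max| by rewrite ler_pM2l // ler_norm.
  rewrite /s; lra.
(* Before division by [s], the move creates slack at least [e] on [S], which pays for the increase
   [h]; off [S] the new weight is 0. *)
have [h h_gt0 hP] := @exists_small_scale F k.+1 (fun=> e) (fun j => g j + e * b j)
  (fun=> e_gt0).
exists (r + h), (fun j => (a j + e * c (widen_ord (leqnSn k) j)) / s),
  (fun j => (g j + e * b j) / s); split=> [|j|j|gk0|i lei].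
- by rewrite ltrDl.
- by rewrite divr_ge0 // ltW.
- rewrite mulrA ler_pM2r ?invr_gt0 //; set j' := widen_ord _ j.
  have [Sj|Sj] := boolP (S j').
    have := hP j'; rewrite ger0_norm // => hj; have := ag j; rewrite -/j' => agj.
    rewrite /c Sj /=; nra.
  by rewrite /c (negbTE Sj) bS //; have := ag j; rewrite -/j' gS // !(mulr0, addr0).
- by rewrite gk0 bS ?mulr0 ?addr0 ?mul0r //= gk0 ltxx.
have := ord i lei; have := c_eq i lei; rewrite big_ord_recr /=.
set A := \sum_(j < k) _; set B := \sum_(j < k.+1) _ => AB.
set A' := \sum_(j < k) _; set B' := \sum_(j < k.+1) _ => AB'.
transitivity ((A' + e * A + (B' + e * B)) / s).
  rewrite [RHS]mulrDl; congr (_ + _); rewrite mulr_sumr -big_split mulr_suml;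
  by apply: eq_bigr => j _ /=; ring.
apply: (canLR (mulfK (lt0r_neq0 s_gt0))).
have -> : B = - (A + c ord_max * k%:R ^+ i) by apply/eqP; rewrite -addr_eq0 addrC AB.
by rewrite -AB' /s; ring.
Qed.

Section Order.
Variables (R : realType) (k p : nat).
Implicit Types m : almm R k.

(** The cases 0 and 1 fit the general formula: [j%:R ^+ 0] is 1 even at [j = 0], and at [i = 0] the
    truncated [i.-1] is multiplied by 0. *)
Lemma has_orderP m : (1 <= p)%N ->
  has_order p m <-> forall i, (i <= p)%N ->
    \sum_j alpha m j * j%:R ^+ i
      + \sum_j beta m j * i%:R * j%:R ^+ i.-1 = k%:R ^+ i /\
    \sum_j alpha m j * j%:R ^+ i
      + \sum_j betah m j * i%:R * j%:R ^+ i.-1 = k%:R ^+ i.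
Proof.
move=> p1.
have e0 (b : 'I_k.+1 -> R) : \sum_j b j * 0%:R * j%:R ^+ 0.-1 = 0.
  by rewrite big1 // => j _; rewrite mulr0 mul0r.
have e1 (b : 'I_k.+1 -> R) : \sum_j b j * 1%:R * j%:R ^+ 1.-1 = \sum_j b j.
  by apply: eq_bigr => j _; rewrite !mulr1.
have a0 : \sum_j alpha m j * j%:R ^+ 0 = \sum_j alpha m j.
  by apply: eq_bigr => j _; rewrite mulr1.
have a1 : \sum_j alpha m j * j%:R ^+ 1 = \sum_(j < k) j%:R * alpha m j.
  by apply: eq_bigr => j _; rewrite mulrC.
split=> [[h0 h1 h1' h] [|[|i]] lei|h].
- by rewrite !e0 a0 !addr0.
- by rewrite !e1 a1 expr1.
- exact: h.
have [] := h 0%N isT; have [] := h 1%N p1.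
rewrite !e0 !e1 a0 a1 addr0 expr1 => h1 h1' h0 _; split=> // i /andP[_ lei].
exact: h.
Qed.

End Order.

(** * SSP coefficients and optimality *)

Section SspCoef.
Variables (R : realType) (k : nat).
Implicit Types (m : almm R k) (y : R).

Lemma ssp_coef_le m y (j : 'I_k) (c := beta m (widen_ord (leqnSn k) j)
    + y * betah m (widen_ord (leqnSn k) j)) :
  0 < c -> (ssp_coef m y <= (alpha m j / c)%:E)%E.
Proof.
move=> c_gt0; apply: ge_ereal_sup => _ [r [_ [_ mon]] <-].
rewrite lee_fin ler_pdivlMr //; have := mon j; rewrite /c; lra.
Qed.

(** Where [beta + y betah] is positive, the condition is an upper bound on [r] and passes to the
    supremum; elsewhere it does not depend on [r]. *)
Lemma ssp_coef_attained m y r : 0 < y -> (0 < ssp_coef m y)%E ->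
  ssp_coef m y = r%:E -> monotonicity m r (y * r).
Proof.
move=> y_gt0 /ereal_sup_gt[_ [r1 [r1_ge0 [b_ge0 mon]] <-] _] C_eq.
split=> // j; set j' := widen_ord _ j.
have [bj bhj] := b_ge0 j'; have ybhj : 0 <= y * betah m j' by rewrite mulr_ge0 // ltW.
have := ssp_coef_le m y j; rewrite C_eq /= -/j' lee_fin.
have := mon j; rewrite -/j'.
have : 0 <= r1 * (beta m j' + y * betah m j') by rewrite mulr_ge0 // addr_ge0.
have [c_gt0 _ _ /(_ isT)|c_le0] := ltP 0 (beta m j' + y * betah m j').
  by rewrite ler_pdivlMr //; lra.
have [-> bh0] : beta m j' = 0 /\ y * betah m j' = 0 by split; lra.
have -> : betah m j' = 0 by apply: (mulfI (lt0r_neq0 y_gt0)); rewrite bh0 mulr0.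
lra.
Qed.

(** The closure condition on [S] covers both classes at once: the improved method must be explicit
    only if [m] is. *)
Lemma optimal_beta_eq (p : nat) y (S : set (almm R k)) m :
  (1 <= p)%N -> 0 < y ->
  (forall a g, (beta m ord_max = 0 /\ betah m ord_max = 0 -> g ord_max = 0) ->
     S (Almm a g g)) ->
  optimal S p y m -> forall j, beta m j = betah m j.
Proof.
move=> p1 y_gt0 S_eq [Sm /(has_orderP _ _ _ _ p1) ord ssp C_opt] j0.
apply/eqP; rewrite -subr_eq0; apply/negPn/negP => dj0.
have [_ [r1 [r1_ge0 [b_ge0 _]] <-] _] := ereal_sup_gt ssp.
pose g j := (beta m j + y * betah m j) / (1 + y).
have y1_gt0 : 0 < 1 + y by lra.
have g_ge0 j : 0 <= g j.
  have [bj bhj] := b_ge0 j.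
  by rewrite divr_ge0 ?(ltW y1_gt0) // addr_ge0 // mulr_ge0 // ltW.
have g_eq0 j : g j = 0 -> beta m j = 0 /\ betah m j = 0.
  have [bj bhj] := b_ge0 j.
  move=> /eqP; rewrite mulf_eq0 invr_eq0 (gt_eqF y1_gt0) orbF.
  rewrite paddr_eq0 ?mulr_ge0 ?(ltW y_gt0) // mulf_eq0 (gt_eqF y_gt0) /=.
  by move=> /andP[/eqP -> /eqP ->].
have supp_g : (p < #|[pred j | (0 < g j)%R]|)%N.
  pose d j := beta m j - betah m j.
  apply: leq_trans (support_size_gt _ _ p d j0 dj0 _) _ => [i ltip|].
    (* Subtract the two conditions of index [i.+1] and divide by [i.+1]. *)
    have [e1 e2] := ord i.+1 ltip.
    apply: (mulfI (_ : i.+1%:R != 0 :> R)); first by rewrite pnatr_eq0.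
    rewrite mulr0 mulr_sumr; move: (etrans e1 (esym e2)) => /addrI /eqP.
    rewrite -subr_eq0 -sumrB => /eqP; apply: etrans; apply: eq_bigr => j _ /=.
    by rewrite -!mulrA -mulrBl mulrCA.
  apply: subset_leq_card; apply/fintype.subsetP => j; rewrite !inE => dj.
  rewrite lt_neqAle g_ge0 andbT eq_sym; apply: contraNneq dj => /g_eq0[bj bhj].
  by rewrite /d bj bhj subrr.
(* As [p >= 1], the support has at least two nodes, hence one other than [k]; its monotonicity
   condition makes the SSP coefficient finite. *)
have [j c_gt0] : exists j : 'I_k, 0 < g (widen_ord (leqnSn k) j).
  have : (0 < #|predD1 [pred j | (0 < g j)%R] ord_max|)%N.
    have := leq_ltn_trans p1 supp_g; rewrite (cardD1 ord_max).
    by case: (ord_max \in _) => //; apply: ltnW.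
  move=> /card_gt0P[j]; rewrite !inE => /andP[jmax gj].
  have ltj : (j < k)%N by rewrite ltn_neqAle jmax -ltnS /=.
  by exists (Ordinal ltj); rewrite (_ : widen_ord _ _ = j) //; apply: val_inj.
have [r C_eq] : exists r, ssp_coef m y = r%:E.
  have : 0 < (1 + y) * g (widen_ord (leqnSn k) j) by rewrite mulr_gt0.
  rewrite mulrC divfK ?gt_eqF // => /ssp_coef_le; move: ssp; rewrite /ssp_method.
  by case: (ssp_coef m y) => [r|//|//] _ _; exists r.
have r_gt0 : 0 < r by move: ssp; rewrite /ssp_method C_eq lte_fin.
have [_ mon] := ssp_coef_attained m y r y_gt0 ssp C_eq.
have [||i lei|r' [a' [g' [ltr' g'_ge0 mon' g'max ord']]]] :=
  improve_lmm R k p (r * (1 + y)) (alpha m) g _ g_ge0 _ supp_g.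
- by rewrite mulr_gt0.
- move=> i; have := mon i.
  rewrite -[r * (1 + y) * _]mulrA [(1 + y) * _]mulrC divfK ?gt_eqF //; lra.
(* The condition for [beta] plus [y] times that for [betah] is [1 + y] times the one for [g]. *)
- have [e1 e2] := ord i lei; apply: (mulfI (lt0r_neq0 y1_gt0)).
  rewrite [RHS]mulrDl mul1r -{1}e1 -{1}e2 mulrDr [_ * (_ + _)]mulrDr !mulr_sumr addrACA.
  rewrite -!big_split /=; congr (_ + _); apply: eq_bigr => l _; first by ring.
  rewrite /g; field; lra.
pose m' := Almm a' g' g'.
have mono' : monotonicity m' (r' / (1 + y)) (y * (r' / (1 + y))).
  split=> [l|l]; first by rewrite /= g'_ge0.
  have := mon' l; rewrite /= -subr_ge0; congr (_ <= _); field; lra.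
have lt_r : r < r' / (1 + y) by rewrite ltr_pdivlMr.
have C'_ge : ((r' / (1 + y))%:E <= ssp_coef m' y)%E.
  apply: ereal_sup_ubound; exists (r' / (1 + y)) => //; split=> //.
  by rewrite ltW // (lt_trans r_gt0).
have : (ssp_coef m' y <= ssp_coef m y)%E.
  rewrite C_opt; apply: ereal_sup_ubound; exists m' => //; split.
  - by apply: S_eq => -[b0 bh0]; apply: g'max; rewrite /g b0 bh0 mulr0 addr0 mul0r.
  - by apply/(has_orderP _ _ _ _ p1) => i lei; split; apply: ord'.
  - by rewrite /ssp_method (lt_le_trans _ C'_ge) // lte_fin (lt_trans r_gt0).
by move=> /(le_trans C'_ge); rewrite C_eq lee_fin leNgt lt_r.
Qed.

End SspCoef.

Theorem lemma3p1 (R : realType) (k p : nat) (y : R)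
    (k_ge1 : (1 <= k)%N) (p_ge1 : (1 <= p)%N) (y_gt0 : 0 < y) :
  (forall m : almm R k, optimal [set: almm R k] p y m ->
     forall j : 'I_k.+1, beta m j = betah m j) /\
  (forall m : almm R k, optimal [set m' : almm R k | explicit m'] p y m ->
     forall j : 'I_k.+1, beta m j = betah m j).
Proof.
split=> m opt; apply: optimal_beta_eq (opt) => // a g gm.
case: opt => [ex _ _ _]; split; exact: gm.
Qed.
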